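(* For integers $n \ge 0$ and $s \ge 1$, let $X^{n,s}$ denote the final outcome of the match-and-add-over rolling scheme with $n$ dice, each having $s$ sides, and let $X_1^{n,s}$ denote the sum of the first set of rolls only. Then the following hold. \begin{enumerate} \item For every $s \in \mathbb{Z}_+$: $\mathbb{E}(X^{0,s}) - \mathbb{E}(X_1^{0,s}) = 0$. \item For every $s \in \mathbb{Z}_+$: $\mathbb{E}(X^{1,s}) - \mathbb{E}(X_1^{1,s}) = \infty$. \item For every $n \in \mathbb{Z}_+$: $\mathbb{E}(X^{n,1}) - \mathbb{E}(X_1^{n,1}) = \infty$. \item For every integer $s \ge 2$: $\lim_{n\to\infty}\left(\mathbb{E}(X^{n,s}) - \mathbb{E}(X_1^{n,s})\right) = 0$. \item $\lim_{s\to\infty}\left(\mathbb{E}(X^{2,s}) - \mathbb{E}(X_1^{2,s})\right) = 1$. \item For every integer $n \ge 3$: $\lim_{s\to\infty}\left(\mathbb{E}(X^{n,s}) - \mathbb{E}(X_1^{n,s})\right) = 0$. \end{enumerate}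
   Context: Let $n \in \mathbb{N}=\{0,1,2,\dots\}$ and $s \in \mathbb{Z}_+=\{1,2,\dots\}$ be fixed. On a probability space $(\Omega,\mathbb{P})$ let $Z_j^l$, for $j \in \mathbb{Z}_+$ and $l \in \{1,\dots,n\}$, be mutually independent random variables, each uniformly distributed on $\{1,\dots,s\}$: $\mathbb{P}(Z_j^l = m) = 1/s$ for every $m \in \{1,\dots,s\}$. Here $Z_j^l$ is the value of the $l$-th die in the $j$-th set of rolls. Let $M_0 = \Omega$ and, for $j \ge 1$, let $M_j = \{\omega \in \Omega : Z_j^1(\omega) = Z_j^2(\omega) = \cdots = Z_j^n(\omega)\}$ (the event that the $j$-th set of rolls is a match; for $n \in \{0,1\}$ the condition is vacuous, so $M_j = \Omega$). Define $X_0 = 0$ and, for $j \ge 1$, $$X_j(\omega) = \begin{cases} X_{j-1}(\omega) + \sum_{l=1}^n Z_j^l(\omega) & \text{if } \omega \in \bigcap_{k=0}^{j-1} M_k,\\ X_{j-1}(\omega) & \text{otherwise.}\end{cases}$$ The variable $X_j$ depends on $n$ and $s$ and is written $X_j^{n,s}$ when this is made explicit; in particular $X_1^{n,s} = \sum_{l=1}^n Z_1^l$. The final outcome of the rolling scheme is $X^{n,s} = \lim_{j\to\infty} X_j^{n,s}$ (a nondecreasing limit, with values in $[0,\infty]$). $\mathbb{E}$ denotes expectation, with values in $[0,\infty]$; differences of the form $\infty - c$ with $c$ finite are read as $\infty$. Limits $n\to\infty$ and $s\to\infty$ are taken along integers. *)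

(* Defs.v *)
From HB Require Import structures.
From mathcomp Require Import all_boot all_order all_algebra.
From mathcomp Require Import finmap.
From mathcomp Require Import all_classical all_reals all_analysis.
Import numFieldNormedType.Exports.

Set Implicit Arguments.
Unset Strict Implicit.
Unset Printing Implicit Defensive.

Local Open Scope classical_set_scope.
Local Open Scope ring_scope.

(* Mutual independence of the subfamily of [X] indexed by [D]: the product rule
   over every finite set of indices in [D]. *)
Definition mutual_independence d (T : measurableType d) (R : realType)
    (P : probability T R) d' (T' : measurableType d') (I : choiceType)
    (D : set I) (X : I -> {RV P >-> T'}) : Prop :=
  forall (F : {fset I}) (B : I -> set T'),
    [set` F] `<=` D ->
    (forall i, i \in F -> measurable (B i)) ->
    P (\bigcap_(i in [set` F]) (X i @^-1` B i))
      = (\prod_(i <- F) P (X i @^-1` B i))%E.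

Section Scheme.
Context d (T : measurableType d) (R : realType) (P : probability T R).
Context (n : nat).

(* [Z j l] is the value of die [l] in the [j]-th set of rolls, [j >= 1];
   the entries [Z 0 l] carry no meaning and are left unconstrained.
   The dice are numbered by ['I_n], that is from 0 to n - 1. *)

Definition dice_rolls (s : nat) (Z : nat -> 'I_n -> {RV P >-> nat}) : Prop :=
  mutual_independence [set jl : nat * 'I_n | (0 < jl.1)%N]
    (fun jl => Z jl.1 jl.2)
  /\ forall (j : nat) (l : 'I_n), (0 < j)%N ->
     forall m : nat, (1 <= m <= s)%N ->
       P (Z j l @^-1` [set m]) = (s%:R^-1)%:E.

Definition match_event (Z : nat -> 'I_n -> {RV P >-> nat}) (j : nat) : set T :=
  if j is 0%N then setT
  else [set w | forall l1 l2 : 'I_n, Z j l1 w = Z j l2 w].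

Fixpoint score (Z : nat -> 'I_n -> {RV P >-> nat}) (j : nat) (w : T) : nat :=
  if j is j'.+1 then
    if `[< (\bigcap_(k < j) match_event Z k) w >]
    then (score Z j' w + \sum_(l < n) Z j l w)%N
    else score Z j' w
  else 0%N.

Definition final_score (Z : nat -> 'I_n -> {RV P >-> nat}) (w : T) : \bar R :=
  limn (fun j => ((score Z j w)%:R)%:E).

(* The library's ['E_P[_]] is for real-valued functions only, whence the integral
   for the final score, which may be infinite. *)
Definition expected_gain (Z : nat -> 'I_n -> {RV P >-> nat}) : \bar R :=
  (\int[P]_w final_score Z w - 'E_P[fun w => (score Z 1 w)%:R])%E.

End Scheme.

(* Main.v *)
(* With n >= 1 dice, each set of rolls matches with probability p = s^(1-n),
   independently of the other sets, and the (i+1)-st set counts only if the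
   first i sets match. So it contributes p^i times the mean mu = n(s+1)/2 of one
   set, and the expected gain is mu (p + p^2 + ...), that is +oo if p = 1 and
   mu / (s^(n-1) - 1) if p < 1. *)
Require Import Defs.
From HB Require Import structures.
From mathcomp Require Import all_boot all_order all_algebra.
From mathcomp Require Import finmap.
From mathcomp Require Import all_classical all_reals all_analysis.
From mathcomp Require Import measurable_realfun.
From mathcomp Require Import ring lra zify.
Import numFieldNormedType.Exports.
Import Order.TTheory GRing.Theory Num.Theory.
Set Implicit Arguments.
Unset Strict Implicit.
Unset Printing Implicit Defensive.
Local Open Scope classical_set_scope.
Local Open Scope ring_scope.

(** * Variables uniform on 1, ..., s, and their integrals over an event *)

Lemma sumr_ord_succ (R : realType) (s : nat) :
  \sum_(a < s) (a.+1%:R : R) = s%:R * s.+1%:R / 2.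
Proof.
elim: s => [|s IH]; first by rewrite big_ord0 !mul0r.
by rewrite big_ord_recr/= IH -!natr1; field.
Qed.

Section UniformVariable.
Context (d : measure_display) (T : measurableType d) (R : realType)
  (P : probability T R).

Lemma measurable_preimage_nat (Y : {RV P >-> nat}) (B : set nat) :
  measurable (Y @^-1` B).
Proof. by rewrite -[X in measurable X]setTI; exact: measurable_funP. Qed.

Context (Y : {RV P >-> nat}) (s : nat).
Context (s_gt0 : (0 < s)%N)
  (Yunif : forall m : nat, (1 <= m <= s)%N ->
             P (Y @^-1` [set m]) = (s%:R^-1)%:E).

Let range_event : set T := \big[setU/set0]_(a < s) (Y @^-1` [set a.+1]).

Let measurable_range_event : measurable range_event.
Proof. by apply: bigsetU_measurable => a _; exact: measurable_preimage_nat. Qed.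

Let trivIset_value : trivIset setT (fun a : nat => Y @^-1` [set a.+1]).
Proof. by move=> i j _ _ [w [/= -> []]]. Qed.

(** The [s] disjoint values carry mass [s * (1/s) = 1], so any other value, 0 included, is taken
    with probability zero. *)
Let range_eventC0 : P (~` range_event) = 0.
Proof.
rewrite probability_setC//.
rewrite (@measure_bigsetU _ _ _ P (fun a : nat => Y @^-1` [set a.+1]))//;
  last by move=> i; exact: measurable_preimage_nat.
rewrite (eq_bigr (fun=> (s%:R^-1)%:E)); last by move=> a _; apply: Yunif; rewrite /= ltn_ord.
rewrite sumEFin sumr_const card_ord -(mulr_natr s%:R^-1) mulVf ?subee// pnatr_eq0; lia.
Qed.

Lemma measure_split_uniform (E : set T) : measurable E ->
  P E = (\sum_(a < s) P (E `&` Y @^-1` [set a.+1]))%E.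
Proof.
move=> mE; rewrite -[in LHS](setIT E) -(setUv range_event) setIUr measureU//; last 3 first.
- exact: measurableI.
- by apply: measurableI => //; exact: measurableC.
- by rewrite setIACA setICr setI0.
rewrite [X in (_ + X)%E](_ : _ = 0) ?adde0; last first.
  apply: (@subset_measure0 _ _ _ P _ (~` range_event)) => //.
  - by apply: measurableI => //; exact: measurableC.
  - exact: measurableC.
rewrite big_distrr/=.
rewrite (@measure_bigsetU _ _ _ P (fun a : nat => E `&` Y @^-1` [set a.+1]))//.
- by move=> i; apply: measurableI => //; exact: measurable_preimage_nat.
- exact: trivIset_setIl.
Qed.

(** The hypothesis is what one has when [A] has probability [q] and is independent of the uniform
    [Y]; the result is then [q] times the mean [(s + 1) / 2]. *)
Lemma integral_indic_uniform (A : set T) (q : R) : measurable A ->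
  (forall m : nat, (1 <= m <= s)%N ->
     P (A `&` Y @^-1` [set m]) = (q / s%:R)%:E) ->
  (\int[P]_w (\1_A w * (Y w)%:R)%:E)%E = (q * (s.+1%:R / 2))%:E.
Proof.
move=> mA AYq.
have mAY a : measurable (A `&` Y @^-1` [set a]).
  by apply: measurableI => //; exact: measurable_preimage_nat.
have mind a : measurable_fun setT (EFin \o \1_(A `&` Y @^-1` [set a])).
  by apply/measurable_EFinP; exact: measurable_indic.
have mterm a b : measurable_fun setT
    (fun w => b%:R%:E * (EFin \o \1_(A `&` Y @^-1` [set a])) w)%E.
  exact: measurable_funeM.
transitivity (\int[P]_w (\sum_(a < s) (a.+1%:R%:E *
   (\1_(A `&` Y @^-1` [set a.+1]) w : R)%:E)))%E.
  apply: ge0_ae_eq_integral => //.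
  - apply/measurable_EFinP; apply: measurable_funM.
      exact: measurable_indic.
    apply: (@measurableT_comp _ _ _ _ _ _ (fun k : nat => k%:R : R)) => //.
  - apply: emeasurable_sum => a; exact: mterm.
  - by move=> w _; apply: sume_ge0 => a _; rewrite -EFinM lee_fin mulr_ge0// indicE.
  (* The integrand and its expansion over the values of [Y] can differ only off the range, which is
     a null set. *)
  exists (~` range_event); split => //; first exact: measurableC.
  move=> w /= /not_implyP[_ Hw] Uw; apply: Hw.
  move: Uw; rewrite /range_event -(bigcup_mkord s (fun a => Y @^-1` [set a.+1])).
  move=> -[a /= a_lt Ya].
  rewrite (bigD1 (Ordinal a_lt))//= big1 ?adde0 => [|b ba].
    rewrite -EFinM !indicE in_setI [X in _ && X]mem_set ?andbT// Ya.
    by rewrite mulrC.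
  rewrite indicE memNset ?mule0//= => -[_]; rewrite Ya => -[]ab.
  by move/eqP: ba; apply; exact: val_inj.
rewrite ge0_integral_sum//; last by move=> a; exact: mterm.
transitivity (\sum_(a < s) (a.+1%:R * (q / s%:R))%:E)%E.
  apply: eq_bigr => a _; rewrite ge0_integralZl//; last exact: mind.
  by rewrite integral_indic// setIT EFinM; congr (_ * _)%E; apply: AYq; rewrite /= ltn_ord.
rewrite sumEFin -mulr_suml sumr_ord_succ; congr (_%:E).
have : s%:R != 0 :> R by rewrite pnatr_eq0; lia.
by move=> s0; field.
Qed.

End UniformVariable.

(** * The score as a series of contributions of single sets of rolls *)

Section Scheme.
Context (d : measure_display) (T : measurableType d) (R : realType)
  (P : probability T R) (n s : nat) (Z : nat -> 'I_n -> {RV P >-> nat}).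

Definition all_matched (i : nat) : set T := \bigcap_(k < i) match_event Z k.

Definition rolls_equal (r : seq (nat * 'I_n)) (b : nat * 'I_n -> nat) : set T :=
  [set w | forall x, x \in r -> Z x.1 x.2 w = b x].

(** The shift makes the series start at the first set: [all_matched i.+1] asks for matches in sets 0
    to [i], and set 0 matches by convention. *)
Definition gain_term (i : nat) (w : T) : R :=
  \1_(all_matched i.+1) w * (\sum_(l < n) Z i.+1 l w)%:R.

Lemma all_matched1 : all_matched 1 = setT.
Proof.
by apply/seteqP; split => // w _ k /=; rewrite ltnS leqn0 => /eqP ->.
Qed.

Lemma all_matchedS (i : nat) :
  all_matched i.+2 = all_matched i.+1 `&` match_event Z i.+1.
Proof.
rewrite /all_matched; apply/seteqP; split => w /=.
  by move=> Mw; split => [k /= ki|]; [exact: Mw k (ltnW ki)|exact: Mw i.+1 (ltnSn _)].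
move=> [Mw Miw] k /=; rewrite ltnS leq_eqVlt => /orP[/eqP ->//|ki]; exact: (Mw k).
Qed.

Lemma measurable_match_event (j : nat) : measurable (match_event Z j).
Proof.
case: j => [|j] //=.
(* Naming the common value of each pair of dice turns a match into a finite intersection of
   countable unions of measurable sets. *)
rewrite [X in measurable X](_ : _ = \bigcap_(l in [set: 'I_n * 'I_n])
  \bigcup_m (Z j.+1 l.1 @^-1` [set m] `&` Z j.+1 l.2 @^-1` [set m])).
  apply: fin_bigcap_measurable => // l _; apply: bigcup_measurable => m _.
  by apply: measurableI; exact: measurable_preimage_nat.
apply/seteqP; split => w /= Zw.
  by move=> [l1 l2] _ /=; exists (Z j.+1 l1 w) => //; split => //=; rewrite (Zw l1 l2).
by move=> l1 l2; have [//|m _ [/= -> ->]] := Zw (l1, l2).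
Qed.

Lemma measurable_all_matched (i : nat) : measurable (all_matched i).
Proof.
by apply: fin_bigcap_measurable => // k _; exact: measurable_match_event.
Qed.

Lemma measurable_rolls_equal r b : measurable (rolls_equal r b).
Proof.
rewrite [X in measurable X](_ : _ =
  \bigcap_(x in [set` r]) (Z x.1 x.2 @^-1` [set b x])).
  by apply: fin_bigcap_measurable => // k _; exact: measurable_preimage_nat.
by apply/seteqP; split.
Qed.

Lemma gain_term_ge0 i w : 0 <= gain_term i w.
Proof. by rewrite mulr_ge0// indicE. Qed.

Lemma measurable_gain_term i : measurable_fun setT (gain_term i).
Proof.
apply: measurable_funM.
  by apply: measurable_indic; exact: measurable_all_matched.
rewrite [X in measurable_fun _ X](_ : _ = (fun w => \sum_(l < n) ((Z i.+1 l w)%:R : R))).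
  apply: measurable_sum => l.
  by apply: (@measurableT_comp _ _ _ _ _ _ (fun k : nat => k%:R : R)).
by apply/funext => w; rewrite natr_sum.
Qed.

Lemma score_sum j w : (score Z j w)%:R = \sum_(i < j) gain_term i w.
Proof.
elim: j => [|j IH]; first by rewrite big_ord0.
rewrite big_ord_recr/= -IH /gain_term indicE; case: asboolP => Mw.
  by rewrite mem_set// mul1r natrD.
by rewrite memNset// mul0r addr0.
Qed.

Lemma final_scoreE w : final_score Z w = (\sum_(i <oo) (gain_term i w)%:E)%E.
Proof.
rewrite /final_score; congr (limn _); apply/funext => j.
by rewrite score_sum sumEFin big_mkord.
Qed.

(** The contributions are nonnegative, so sum and integral may be exchanged even when the total is
    infinite. *)
Lemma expected_gainE : expected_gain Z =
  (\sum_(i <oo) \int[P]_w (gain_term i w)%:E - \int[P]_w (gain_term 0 w)%:E)%E.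
Proof.
rewrite /expected_gain; congr (_ - _)%E.
  under eq_integral do rewrite final_scoreE.
  rewrite integral_nneseries//.
  - by move=> i; apply/measurable_EFinP; exact: measurable_gain_term.
  - by move=> i w _; rewrite lee_fin gain_term_ge0.
rewrite unlock; apply: eq_integral => w _.
by rewrite score_sum big_ord1.
Qed.

Context (hZ : dice_rolls s Z).

Lemma measure_rolls_equal r b : uniq r ->
  (forall x, x \in r -> (0 < x.1)%N && (1 <= b x <= s)%N) ->
  P (rolls_equal r b) = (s%:R^-1 ^+ size r)%:E.
Proof.
move=> r_uniq r_b; have [indep unif] := hZ.
(* Independence is phrased for finite sets of indices; as [r] has no repetition, the product over
   [F] has exactly [size r] factors. *)
have [F F_r F_perm] : exists2 F : {fset nat * 'I_n}, F =i r & perm_eq F (undup r).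
  by exists (seq_fset tt r); [exact: seq_fsetE|exact: seq_fset_perm].
have := indep F (fun x => [set b x]).
rewrite (_ : \bigcap_(i in _) _ = rolls_equal r b); last first.
  by apply/seteqP; split => w Zw x xr; apply: Zw; move: xr; rewrite /= F_r.
move=> -> //; last by move=> x /=; rewrite F_r => /r_b/andP[].
rewrite (perm_big _ F_perm)/=.
rewrite undup_id// (eq_big_seq (fun=> (s%:R^-1)%:E)); last first.
  by move=> x /r_b/andP[x0 bx]; exact: unif.
elim: (r) => [|x r' IH]; first by rewrite big_nil expr0.
by rewrite big_cons IH exprS EFinM.
Qed.

End Scheme.

(** * Match probabilities and closed forms of the gain for at least one die *)

Section PositiveDice.
Context (d : measure_display) (T : measurableType d) (R : realType)
  (P : probability T R) (n s : nat) (Z : nat -> 'I_n.+1 -> {RV P >-> nat}).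
Context (s_gt0 : (0 < s)%N) (hZ : dice_rolls s Z).

Let match_prob : R := s%:R^-1 ^+ n.

(* Carrying along a prescription [b] of later rolls makes the induction go
   through: once split according to the value [a.+1] of its first die, a match
   in set [i.+1] is one more prescription. *)
Lemma measure_all_matched i r b : uniq r ->
  (forall x, x \in r -> (i < x.1)%N && (1 <= b x <= s)%N) ->
  P (all_matched Z i.+1 `&` rolls_equal Z r b) =
  (match_prob ^+ i * s%:R^-1 ^+ size r)%:E.
Proof.
elim: i r b => [|i IH] r b r_uniq r_b.
  rewrite all_matched1 setTI expr0 mul1r.
  exact: (measure_rolls_equal hZ).
have unif m : (1 <= m <= s)%N -> P (Z i.+1 ord0 @^-1` [set m]) = (s%:R^-1)%:E.
  exact: hZ.2.
rewrite (measure_split_uniform s_gt0 unif); last first.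
  by apply: measurableI; [exact: measurable_all_matched|exact: measurable_rolls_equal].
pose r' := [seq (i.+1, l) | l <- enum 'I_n.+1].
(* [r'] lists the dice of set [i.+1], whereas [r] concerns later sets only. *)
have rr'_uniq : uniq (r' ++ r).
  rewrite cat_uniq r_uniq andbT map_inj_uniq ?enum_uniq//=; last by move=> ? ? [].
  apply/hasPn => x /r_b/andP[ix _]; apply/mapP => -[l _ xE].
  by move: ix; rewrite xE ltnn.
pose b' a (x : nat * 'I_n.+1) := if x.1 == i.+1 then a.+1 else b x.
(* The [n.+1] new prescriptions cost [s^-(n+1)]; summing over the [s] common values leaves [s^-n],
   one more factor [match_prob]. *)
rewrite (eq_bigr (fun=> (match_prob ^+ i * s%:R^-1 ^+ size (r' ++ r))%:E)) => [|a _].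
  rewrite sumEFin sumr_const card_ord; congr (_%:E).
  rewrite size_cat size_map size_enum_ord -(mulr_natr (_ * _) s) exprSr exprD exprS.
  rewrite -/match_prob; set p := match_prob; set q := (s%:R^-1 : R) ^+ size r.
  transitivity (p ^+ i * p * q * (s%:R^-1 * s%:R : R)); first by ring.
  by rewrite mulVf ?mulr1// pnatr_eq0 -lt0n.
rewrite -(IH _ (b' a))//; last first.
  move=> x; rewrite /b' mem_cat => /orP[/mapP[l _ ->]|/r_b/andP[ix bx]] /=.
    by rewrite eqxx ltnSn /= ltn_ord.
  by rewrite ltnW//= gtn_eqF.
congr (P _); rewrite all_matchedS; apply/seteqP; split => w /=.
  move=> [[[Mw match_w] Zw] Za]; split => // x; rewrite mem_cat.
  move=> /orP[/mapP[l _ ->]|xr]; rewrite /b' /=.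
    by rewrite eqxx -Za; exact: match_w.
  by case/r_b/andP: (xr) => ix _; rewrite gtn_eqF//; exact: Zw.
move=> [Mw Zw].
have Za l : Z i.+1 l w = a.+1.
  rewrite (Zw (i.+1, l)) /b' ?eqxx//= mem_cat map_f// mem_enum.
  by [].
split => //; split; first by split => // l1 l2; rewrite !Za.
move=> x xr; have := Zw x; rewrite mem_cat xr orbT => ->//.
by case/r_b/andP: xr => ix _; rewrite /b' gtn_eqF.
Qed.

Lemma integral_gain_term i : (\int[P]_w (gain_term Z i w)%:E)%E =
  (n.+1%:R * (s.+1%:R / 2) * match_prob ^+ i)%:E.
Proof.
transitivity (\int[P]_w \sum_(l < n.+1)
    (\1_(all_matched Z i.+1) w * (Z i.+1 l w)%:R)%:E)%E.
  by apply: eq_integral => w _; rewrite sumEFin -mulr_sumr /gain_term natr_sum.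
rewrite ge0_integral_sum//; last first.
  move=> l; apply/measurable_EFinP; apply: measurable_funM.
    by apply: measurable_indic; exact: measurable_all_matched.
  exact: (@measurableT_comp _ _ _ _ _ _ (fun k : nat => k%:R : R)).
rewrite (eq_bigr (fun=> (match_prob ^+ i * (s.+1%:R / 2))%:E)) => [|l _].
  rewrite sumEFin sumr_const card_ord; congr (_%:E).
  by rewrite -mulr_natl; ring.
have unif m : (1 <= m <= s)%N -> P (Z i.+1 l @^-1` [set m]) = (s%:R^-1)%:E.
  exact: hZ.2.
apply: (integral_indic_uniform s_gt0 unif); first exact: measurable_all_matched.
(* Prescribing this single later roll gives the joint probability [match_prob ^+ i / s]. *)
move=> m ms; have := @measure_all_matched i [:: (i.+1, l)] (fun=> m).
rewrite expr1 => <-//; last by move=> x; rewrite inE => /eqP ->; rewrite ltnSn.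
congr (P (_ `&` _)); apply/seteqP; split => w /=.
  by move=> Zm x; rewrite inE => /eqP ->.
by move=> /(_ (i.+1, l)); apply; rewrite inE.
Qed.

Lemma expected_gain_series :
  expected_gain Z =
  (\sum_(i <oo) (n.+1%:R * (s.+1%:R / 2) * match_prob ^+ i)%:E
    - (n.+1%:R * (s.+1%:R / 2))%:E)%E.
Proof.
rewrite expected_gainE integral_gain_term mulr1; congr (_ - _)%E.
by apply: eq_eseriesr => i _; rewrite integral_gain_term.
Qed.

(** All terms of the series equal the same positive mean. The hypothesis covers both a single die
    ([n = 0]) and one-sided dice ([s = 1]). *)
Lemma expected_gain_pinfty : match_prob = 1 -> expected_gain Z = +oo%E.
Proof.
move=> p1; rewrite expected_gain_series p1.
rewrite (_ : (\sum_(i <oo) _)%E = +oo%E)//; apply/cvg_lim => //.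
rewrite (_ : (fun _ => _) =
  (fun k => (k%:R * (n.+1%:R * (s.+1%:R / 2)) : R)%:E)); last first.
  apply/funext => k; rewrite sumEFin big_mkord; congr (_%:E).
  under eq_bigr do rewrite expr1n mulr1.
  by rewrite sumr_const card_ord -[LHS]mulr_natl.
apply/cvgeryP.
have mu_gt0 : 0 < n.+1%:R * (s.+1%:R / 2) :> R by rewrite mulr_gt0// divr_gt0.
exact: (@gt0_cvgMly R ((k%:R : R) @[k --> \oo]) _ _ id mu_gt0 cvgr_idn).
Qed.

(** With [p = s^-n < 1] the geometric series gives [mu / (1 - p) - mu = mu / (s^n - 1)]; the number
    of dice is [n.+1]. *)
Lemma expected_gain_fin : (1 < s)%N -> (0 < n)%N ->
  expected_gain Z = (n.+1%:R * s.+1%:R / 2 / (s%:R ^+ n - 1))%:E.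
Proof.
move=> s_gt1 n_gt0.
have p_lt1 : match_prob < 1.
  by rewrite exprn_ilt1 ?invr_ge0// -?lt0n// invf_lt1 ?ltr0n ?ltr1n.
have sn : s%:R ^+ n - 1 != 0 :> R.
  rewrite subr_eq0 gt_eqF// exprn_egt1 ?ltr1n//; lia.
have s0 : s%:R != 0 :> R by rewrite pnatr_eq0; lia.
have p_ge0 : 0 <= match_prob by rewrite exprn_ge0// invr_ge0.
rewrite expected_gain_series.
rewrite (_ : (\sum_(i <oo) _)%E = (n.+1%:R * (s.+1%:R / 2) / (1 - match_prob))%:E).
  rewrite -EFinB; congr (_%:E); rewrite /match_prob exprVn.
  have sn0 : s%:R ^+ n != 0 :> R by rewrite expf_neq0.
  have -> : 1 - (s%:R ^+ n)^-1 = (s%:R ^+ n - 1) / s%:R ^+ n :> R by field.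
  by field; rewrite sn.
apply/cvg_lim => //.
have p_norm : `|match_prob| < 1 by rewrite ger0_norm.
apply: cvg_EFin; first by apply: nearW => k; rewrite sumEFin.
have := cvg_geometric_series (a := n.+1%:R * (s.+1%:R / 2)) p_norm.
apply: cvg_trans; apply: near_eq_cvg; apply: nearW => k /=.
by rewrite sumEFin.
Qed.

End PositiveDice.

(** * The case without dice, and the limits *)

Lemma expected_gain_no_dice (d : measure_display) (T : measurableType d)
    (R : realType) (P : probability T R) (Z : nat -> 'I_0 -> {RV P >-> nat}) :
  expected_gain Z = 0%E.
Proof.
have term0 i : (\int[P]_w (gain_term Z i w)%:E = 0)%E.
  by apply: integral0_eq => w _; rewrite /gain_term big_ord0 mulr0.
by rewrite expected_gainE term0 sube0 eseries0// => i _ _; exact: term0.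
Qed.

(** Quadratic growth is needed against the linear numerator as the number of dice grows; the summand
    2 absorbs the [- 1] in the denominator [s^n - 1]. *)
Lemma leq_triangular_pow2 (m : nat) : (m * m.+1 + 2 <= 2 ^ m.+1)%N.
Proof.
by elim: m => [//|m IH]; rewrite expnS; nia.
Qed.

Lemma squeeze_harmonic (R : realType) (u : nat -> R) (c : R) :
  (forall k, 0 <= u k <= c * harmonic k) ->
  (fun k => (u k)%:E) @ \oo --> 0%E.
Proof.
move=> u_bnd; apply: cvg_EFin; first exact: nearW.
apply: (@squeeze_cvgr _ _ _ _ (fun=> 0) (fun k => c * harmonic k)).
- by apply: nearW => k /=; exact: u_bnd.
- exact: cvg_cst.
- by rewrite -[X in _ --> X](mulr0 c); apply: cvgMr => //; exact: cvg_harmonic.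
Qed.

Theorem theorem2p7 (R : realType)
    (d : nat -> nat -> measure_display)
    (T : forall n s : nat, measurableType (d n s))
    (P : forall n s : nat, probability (T n s) R)
    (Z : forall n s : nat, nat -> 'I_n -> {RV (P n s) >-> nat})
    (hZ : forall n s : nat, (1 <= s)%N -> dice_rolls s (Z n s)) :
  (forall s : nat, (1 <= s)%N -> expected_gain (Z 0%N s) = 0%E)
  /\ (forall s : nat, (1 <= s)%N -> expected_gain (Z 1%N s) = +oo%E)
  /\ (forall n : nat, (1 <= n)%N -> expected_gain (Z n 1%N) = +oo%E)
  /\ (forall s : nat, (2 <= s)%N ->
        (fun n : nat => expected_gain (Z n s)) @ \oo --> 0%E)
  /\ (fun s : nat => expected_gain (Z 2%N s)) @ \oo --> 1%E
  /\ (forall n : nat, (3 <= n)%N ->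
        (fun s : nat => expected_gain (Z n s)) @ \oo --> 0%E).
Proof.
split; [|split; [|split; [|split; [|split]]]].
- by move=> s _; exact: expected_gain_no_dice.
- by move=> s s1; apply: (expected_gain_pinfty s1 (hZ 1 _ s1)); rewrite expr0.
- move=> [//|n] _; apply: (expected_gain_pinfty _ (hZ n.+1 1 _)) => //.
  by rewrite invr1 expr1n.
- move=> s s2; have s1 : (0 < s)%N by exact: ltnW.
  (* From two dice on, the closed form applies. *)
  rewrite -(cvg_shiftn 2)/=.
  rewrite (_ : (fun _ => _) = (fun n => (n.+2%:R * s.+1%:R / 2 /
    (s%:R ^+ n.+1 - 1) : R)%:E)); last first.
    by apply/funext => n; rewrite addn2 (expected_gain_fin s1 (hZ _ _ s1)).
  apply: (@squeeze_harmonic _ _ s.+1%:R) => k.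
  (* This is the bound of the gain by [(s + 1) / (k + 1)] with denominators cleared. *)
  have pow_ge : (k.+1%:R * k.+2%:R : R) <= 2 * (s%:R ^+ k.+1 - 1).
    rewrite mulrBr mulr1 lerBrDr -natrX -!natrM -natrD ler_nat.
    have := leq_triangular_pow2 k.+1; have := leq_exp2r 2 s (ltn0Sn k).
    by rewrite s2 [X in (_ <= X)%N -> _]expnS; lia.
  have pow_gt0 : 0 < s%:R ^+ k.+1 - 1 :> R.
    by rewrite subr_gt0 exprn_egt1// ltr1n.
  rewrite !mulr_ge0 ?invr_ge0 ?(ltW pow_gt0)//=.
  rewrite /harmonic ler_pdivrMr// [leRHS]mulrAC ler_pdivlMr//.
  have := ler_wpM2l (ler0n R s.+1) pow_ge.
  by lra.
- rewrite -(cvg_shiftn 2).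
  (* Two dice with [s + 2] sides gain [(s + 3) / (s + 1) = 1 + 2 / (s + 1)]. *)
  rewrite (_ : (fun _ => _) = (fun s => 1%:E + (2 * @harmonic R s)%:E)%E); last first.
    apply/funext => s; have s1 : (0 < s + 2)%N by rewrite addn2.
    rewrite (expected_gain_fin s1 (hZ _ _ s1)) ?addn2// -EFinD; congr (_%:E).
    rewrite /harmonic/= expr1; have : s.+1%:R != 0 :> R by [].
    rewrite -(natr1 s.+2) -(natr1 s.+1) -[_ + 1 - 1]addrA subrr addr0 => s0.
    by field.
  suff : (fun s => 1%:E + (2 * @harmonic R s)%:E)%E @ \oo --> (1%:E + 0)%E.
    by rewrite adde0.
  apply: cvgeD => //; first exact: cvg_cst.
  by apply: (@squeeze_harmonic _ _ 2) => k; rewrite lexx mulr_ge0// invr_ge0.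
- move=> [|[|[|n]]]// _; rewrite -(cvg_shiftn 2)/=.
  rewrite (_ : (fun _ => _) = (fun s => (n.+3%:R * s.+3%:R / 2 /
    (s.+2%:R ^+ n.+2 - 1) : R)%:E)); last first.
    apply/funext => s; have s1 : (0 < s + 2)%N by rewrite addn2.
    by rewrite (expected_gain_fin s1 (hZ _ _ s1)) ?addn2.
  apply: (@squeeze_harmonic _ _ n.+3%:R) => k.
  (* The left side is [(k + 2)^2 - 1]; its factor [k + 3] cancels the numerator and leaves a bound
     of order [1 / (k + 1)]. *)
  have pow_ge : k.+1%:R * k.+3%:R <= k.+2%:R ^+ n.+2 - 1 :> R.
    rewrite lerBrDr -natrX -natrM natr1 ler_nat.
    apply: (@leq_trans (k.+2 ^ 2)%N); first by lia.
    by rewrite leq_exp2l.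
  have pow_gt0 : 0 < k.+2%:R ^+ n.+2 - 1 :> R.
    by apply: lt_le_trans pow_ge; rewrite mulr_gt0.
  rewrite !mulr_ge0 ?invr_ge0 ?(ltW pow_gt0)//=.
  rewrite /harmonic ler_pdivrMr// [leRHS]mulrAC ler_pdivlMr//.
  have := ler_wpM2l (ler0n R n.+3) pow_ge.
  have : 0 <= n.+3%:R * (k.+1%:R * k.+3%:R) :> R by rewrite !mulr_ge0.
  by lra.
Qed.
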